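(* Let $\mathcal{A}\in\mathbb{C}^{m\times n\times r}$, $\mathcal{B}\in\mathbb{C}^{h\times k\times r}$, $\mathcal{C}\in\mathbb{C}^{a\times b\times r}$, $\mathcal{D}\in\mathbb{C}^{l\times d\times r}$ with $m\neq h$, and let $p,q$ be positive integers with $l\neq p$ such that, with $t_1=[n,p]$ and $t_2=[q,a]$, one has $\frac{mt_1}{n}=h$, $\frac{qt_1}{p}=k$, $\frac{pt_2}{q}=l$, $\frac{bt_2}{a}=d$. Put $\alpha=\frac{k}{q}$ and $\beta=\frac{l}{p}$. Partition $\mathcal{B}$ into blocks $\operatorname{Block}_{uj}(\mathcal{B})\in\mathbb{C}^{\frac{h}{m}\times\alpha\times r}$ ($u=1,\dots,m$, $j=1,\dots,q$) and $\mathcal{D}$ into blocks $\operatorname{Block}_{gs}(\mathcal{D})\in\mathbb{C}^{\beta\times\frac{d}{b}\times r}$ ($g=1,\dots,p$, $s=1,\dots,b$). Then the solvability of the system $\mathcal{A}\ltimes X=\mathcal{B}$, $X\ltimes\mathcal{C}=\mathcal{D}$ with $X\in\mathbb{C}^{p\times q}$ is equivalent to the following: all blocks $\operatorname{Block}_{uj}(\mathcal{B})$ and $\operatorname{Block}_{gs}(\mathcal{D})$ are Toeplitz tensors, and there is a matrix $X\in\mathbb{C}^{p\times q}$ with columns $X_1,\dots,X_q$ and rows $Y_1,\dots,Y_p$ satisfying $$\mathcal{A}\ltimes X_j=\mathcal{B}_j=\begin{bmatrix}\operatorname{Block}_{1j}(\mathcal{B})\\ \operatorname{Block}_{2j}(\mathcal{B})\\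 \vdots\\ \operatorname{Block}_{mj}(\mathcal{B})\end{bmatrix}\in\mathbb{C}^{h\times\alpha\times r},\qquad j=1,\dots,q,$$ $$Y_g\ltimes\mathcal{C}=\mathcal{D}_g=[\operatorname{Block}_{g1}(\mathcal{D}),\dots,\operatorname{Block}_{gb}(\mathcal{D})]\in\mathbb{C}^{\beta\times d\times r},\qquad g=1,\dots,p.$$
   Context: Tensors are third-order arrays over $\mathbb{C}$, with all dimensions positive integers. A matrix in $\mathbb{C}^{p\times q}$ (in particular a column $X_j\in\mathbb{C}^{p\times1}$ or a row $Y_g\in\mathbb{C}^{1\times q}$) is regarded as a third-order tensor with third dimension $1$. Block partitions split the first two indices into consecutive intervals of equal lengths, keeping the full third index. A third-order tensor is a Toeplitz tensor if every frontal slice (third index fixed) is a Toeplitz matrix, i.e. its entries $a_{i_1,i_2,i_3}$ depend only on $i_1-i_2$ and $i_3$. $[x,y]$ for two integers denotes the least common multiple. $I_{n\times n\times k}$ is the identity tensor: its first frontal slice is the $n\times n$ identity matrix and its other frontal slices are zero. The Kronecker product of $\mathcal{A}\in\mathbb{C}^{n_1\times n_2\times n_3}$ and $\mathcal{B}\in\mathbb{C}^{p_1\times p_2\times p_3}$ is the $n_1p_1\times n_2p_2\times n_3p_3$ tensor whose entry at position $((i_1-1)p_1+j_1,(i_2-1)p_2+j_2,(i_3-1)p_3+j_3)$ is $a_{i_1i_2i_3}b_{j_1j_2j_3}$. The t-product of $\mathcal{A}\in\mathbb{C}^{m\times n\times r}$ and $\mathcal{B}\in\mathbb{C}^{n\times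 s\times r}$ is $\mathcal{A}*\mathcal{B}\in\mathbb{C}^{m\times s\times r}$ whose $k$-th frontal slice is $\sum_{i+j\equiv k+1\ (\mathrm{mod}\ r)}\mathcal{A}_{(::i)}\mathcal{B}_{(::j)}$ (sum over $1\le i,j\le r$). The semi-tensor product of $\mathcal{A}\in\mathbb{C}^{m\times n\times r}$ and $\mathcal{B}\in\mathbb{C}^{p\times q\times s}$ is $\mathcal{A}\ltimes\mathcal{B}=(\mathcal{A}\otimes I_{\frac{t}{n}\times\frac{t}{n}\times\frac{e}{r}})*(\mathcal{B}\otimes I_{\frac{t}{p}\times\frac{t}{p}\times\frac{e}{s}})\in\mathbb{C}^{\frac{mt}{n}\times\frac{qt}{p}\times e}$, where $t=[n,p]$ and $e=[r,s]$. *)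

(* Defs.v *)
From HB Require Import structures.
From mathcomp Require Import all_boot all_order all_algebra.
From mathcomp Require Import reals.
From mathcomp Require Import complex mxtens.

Set Implicit Arguments.
Unset Strict Implicit.
Unset Printing Implicit Defensive.

Import GRing.Theory.
Local Open Scope ring_scope.

(* An m x n x r tensor is the family of its r frontal slices; all indices are
   0-based. *)
Definition tensor (K : Type) (m n r : nat) := {ffun 'I_r -> 'M[K]_(m, n)}.

Definition mx_tensor (K : Type) (p q : nat) (X : 'M[K]_(p, q)) :
  tensor K p q 1 := [ffun _ => X].

Definition tcast (K : Type) (m n r m' n' r' : nat)
    (em : m = m') (en : n = n') (er : r = r') (A : tensor K m n r) :
  tensor K m' n' r' :=
  [ffun k => castmx (em, en) (A (cast_ord (esym er) k))].

(* Equality of tensors whose sizes are only propositionally equal: the sizes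
   agree and so do the entries. *)
Definition teq (K : Type) (m n r m' n' r' : nat)
    (A : tensor K m n r) (B : tensor K m' n' r') : Prop :=
  exists (em : m = m') (en : n = n') (er : r = r'), tcast em en er A = B.

Definition id_tensor (K : pzRingType) (n k : nat) : tensor K n n k :=
  [ffun i : 'I_k => if (i : nat) == 0%N then 1%:M else 0].

(* [mxtens_unindex] sends i < r * s to the pair (i %/ s, i %% s), which is the
   0-based form of the index (i_3 - 1) s + j_3. *)
Definition tkron (K : pzRingType) (m n r p q s : nat)
    (A : tensor K m n r) (B : tensor K p q s) :
  tensor K (m * p) (n * q) (r * s) :=
  [ffun k => tensmx (A (mxtens_unindex k).1) (B (mxtens_unindex k).2)].

(* With 0-based slice indices the condition i + j = k + 1 (mod r) reads
   i + j = k (mod r). *)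
Definition tprod (K : pzRingType) (m n s r : nat)
    (A : tensor K m n r) (B : tensor K n s r) : tensor K m s r :=
  [ffun k : 'I_r =>
    \sum_(i < r) \sum_(j < r | (i + j == k %[mod r])%N) A i *m B j].

Lemma muln_lcmn_divl (n p : nat) : (n * (lcmn n p %/ n) = lcmn n p)%N.
Proof. by rewrite mulnC divnK ?dvdn_lcml. Qed.

Lemma muln_lcmn_divr (n p : nat) : (p * (lcmn n p %/ p) = lcmn n p)%N.
Proof. by rewrite mulnC divnK ?dvdn_lcmr. Qed.

(* The casts give the two factors of the t-product the common inner size
   lcm(n, p) and the common third size lcm(r, s). *)
Definition stprod (K : pzRingType) (m n r p q s : nat)
    (A : tensor K m n r) (B : tensor K p q s) :
  tensor K (m * (lcmn n p %/ n)) (q * (lcmn n p %/ p)) (lcmn r s) :=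
  tprod
    (tcast erefl (muln_lcmn_divl n p) (muln_lcmn_divl r s)
       (tkron A (id_tensor K (lcmn n p %/ n) (lcmn r s %/ r))))
    (tcast (muln_lcmn_divr n p) erefl (muln_lcmn_divr r s)
       (tkron B (id_tensor K (lcmn n p %/ p) (lcmn r s %/ s)))).

Definition toeplitz_mx (K : Type) (m n : nat) (M : 'M[K]_(m, n)) : Prop :=
  forall (i i' : 'I_m) (j j' : 'I_n),
    i%:Z - j%:Z = i'%:Z - j'%:Z -> M i j = M i' j'.

Definition toeplitz_tensor (K : Type) (m n r : nat) (A : tensor K m n r) :
  Prop := forall k : 'I_r, toeplitz_mx (A k).

Lemma block_ord_subproof (h m : nat) (u : 'I_m) (i : 'I_(h %/ m)) :
  (u * (h %/ m) + i < h)%N.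
Proof.
apply: leq_trans (leq_divM h m); rewrite [leqRHS]mulnC; apply: leq_trans (leq_mul (ltn_ord u) (leqnn _)).
by rewrite mulSn addnC ltn_add2r.
Qed.

(* Position in 'I_h of the i-th element of the u-th of m consecutive intervals
   of length h / m. *)
Definition block_ord (h m : nat) (u : 'I_m) (i : 'I_(h %/ m)) : 'I_h :=
  Ordinal (block_ord_subproof u i).

(* Block (u, j) of the partition of A into m x q equal blocks. *)
Definition tblock (K : Type) (h k r m q : nat) (A : tensor K h k r)
    (u : 'I_m) (j : 'I_q) : tensor K (h %/ m) (k %/ q) r :=
  [ffun c => mxsub (block_ord u) (block_ord j) (A c)].

Definition tvstack (K : Type) (m x y r : nat) (T : 'I_m -> tensor K x y r) :
  tensor K (m * x) y r :=
  [ffun c => \matrix_(i, j) T (mxtens_unindex i).1 c (mxtens_unindex i).2 j].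

Definition thstack (K : Type) (b x y r : nat) (T : 'I_b -> tensor K x y r) :
  tensor K x (b * y) r :=
  [ffun c => \matrix_(i, j) T (mxtens_unindex j).1 c i (mxtens_unindex j).2].

(* Main.v *)
(* With t = lcm(n, p), the entry of A x| X at row (u, i) and column (v, j) is a
   sum over the w < t with w = i mod t/n and w = j mod t/p, whose term depends
   only on u, v and the two quotients of w. Shifting w by x gives a bijection
   onto the indices for (i + x, j + x) without changing the quotients, so every
   block is Toeplitz. The column block v involves only column v of X (and
   symmetrically for rows), so the full equations split into the equations for
   the columns and the rows of X. *)
Require Import Defs.
From HB Require Import structures.
From mathcomp Require Import all_boot all_order all_algebra.
From mathcomp Require Import reals.
From mathcomp Require Import complex mxtens.
From mathcomp Require Import zify.

Local Open Scope ring_scope.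
Local Open Scope complex_scope.

Import GRing.Theory.

Set Implicit Arguments.
Unset Strict Implicit.
Unset Printing Implicit Defensive.

(** * Entries of tensors and of semi-tensor products *)

(* The entry at natural-number indices, with junk value 0 out of range; it is
   insensitive to casts of the sizes. *)
Definition tent (K : nmodType) (m n r : nat) (A : tensor K m n r)
    (k i j : nat) : K :=
  if (insub k, insub i, insub j) is (Some k', Some i', Some j')
  then A k' i' j' else 0.

Arguments tent {K m n r} A (k i j)%_N.

Lemma tentE (K : nmodType) (m n r : nat) (A : tensor K m n r)
    (k : 'I_r) (i : 'I_m) (j : 'I_n) : tent A k i j = A k i j.
Proof. by rewrite /tent !valK. Qed.

Lemma tent_ord (K : nmodType) (m n r : nat) (A : tensor K m n r)
    (k i j : nat) (hk : (k < r)%N) (hi : (i < m)%N) (hj : (j < n)%N) :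
  tent A k i j = A (Ordinal hk) (Ordinal hi) (Ordinal hj).
Proof. exact: (tentE A (Ordinal hk) (Ordinal hi) (Ordinal hj)). Qed.

Lemma tent_tcast (K : nmodType) (m n r m' n' r' : nat)
    (em : m = m') (en : n = n') (er : r = r') (A : tensor K m n r) :
  tent (Defs.tcast em en er A) =2 tent A.
Proof.
case: m' / em; case: n' / en; case: r' / er => k i.
suff -> : Defs.tcast erefl erefl erefl A = A by [].
by apply/ffunP => c; rewrite ffunE castmx_id cast_ord_id.
Qed.

(** Trades the casts of [teq] for size equations and a comparison of entries at natural-number
    indices. *)
Lemma teqP (K : nmodType) (m n r m' n' r' : nat)
    (A : tensor K m n r) (B : tensor K m' n' r') :
  teq A B <->
  [/\ m = m', n = n', r = r' &
      forall k i j : nat, (k < r)%N -> (i < m)%N -> (j < n)%N ->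
        tent A k i j = tent B k i j].
Proof.
split=> [[em [en [er <-]]]|[em en er AB]].
  by split=> // k i j _ _ _; rewrite tent_tcast.
exists em, en, er; apply/ffunP => k; apply/matrixP => i j.
rewrite -[LHS]tentE -[RHS]tentE tent_tcast AB //.
- by rewrite er.
- by rewrite em.
- by rewrite en.
Qed.

(** The identity factor is supported on the diagonal of slice 0, so it acts as a Boolean
    multiplicity. *)
Lemma tent_tkron_id (K : pzRingType) (m n r N M : nat) (A : tensor K m n r)
    (k i j : nat) : (k < r * M)%N -> (i < m * N)%N -> (j < n * N)%N ->
  tent (tkron A (id_tensor K N M)) k i j =
  tent A (k %/ M) (i %/ N) (j %/ N) *+
    ((k %% M == 0) && (i %% N == j %% N))%N.
Proof.
move=> hk hi hj; rewrite tent_ord ffunE !mxE ffunE -tentE /= -mulr_natr.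
by case: ifP; rewrite !mxE.
Qed.

(** The inner index [w] ranges over natural numbers, not ordinals, so that the sum can later be cut
    and translated. *)
Lemma tent_stprod (K : pzRingType) (m n r p q s : nat)
    (A : tensor K m n r) (B : tensor K p q s) (k i j : nat) :
  let t := lcmn n p in let e := lcmn r s in
  (k < e)%N -> (i < m * (t %/ n))%N -> (j < q * (t %/ p))%N ->
  tent (stprod A B) k i j =
  \sum_(c < e) \sum_(c' < e | (c + c' == k %[mod e])%N) \sum_(0 <= w < t)
    (tent A (c %/ (e %/ r)) (i %/ (t %/ n)) (w %/ (t %/ n)) *+
       ((c %% (e %/ r) == 0) && (i %% (t %/ n) == w %% (t %/ n)))%N) *
    (tent B (c' %/ (e %/ s)) (w %/ (t %/ p)) (j %/ (t %/ p)) *+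
       ((c' %% (e %/ s) == 0) && (w %% (t %/ p) == j %% (t %/ p)))%N).
Proof.
move=> t e hk hi hj; rewrite tent_ord ffunE !summxE.
apply: eq_bigr => c _; rewrite summxE; apply: eq_bigr => c' _.
rewrite mxE big_mkord; apply: eq_bigr => w _.
rewrite -!tentE !tent_tcast !tent_tkron_id //=;
  by rewrite ?muln_lcmn_divl ?muln_lcmn_divr.
Qed.

(** * Toeplitz structure of the blocks of a semi-tensor product *)

Lemma divn_mod_shift (e w i x : nat) : (i + x < e)%N -> (w %% e)%N = i ->
  ((w + x) %/ e = w %/ e)%N.
Proof.
move=> ix we; have e_gt0 : (0 < e)%N by exact: leq_ltn_trans ix.
by rewrite {1}(divn_eq w e) we -addnA divnMDl // (divn_small ix) addn0.
Qed.

(* Replacing [w] by [w + x] matches the two sums term by term: the residues of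
   [w] do not wrap around, so both quotients are unchanged. *)
Lemma sum_residue_shift (K : pzSemiRingType) (t e a i j x : nat)
    (f g : nat -> K) :
  (e %| t)%N -> (i + x < e)%N -> (j + x < a)%N -> (x <= t)%N ->
  \sum_(0 <= w < t)
    (f (w %/ e)%N *+ (i == w %% e)%N) * (g (w %/ a)%N *+ (w %% a == j)%N) =
  \sum_(0 <= w < t)
    (f (w %/ e)%N *+ (i + x == w %% e)%N) * (g (w %/ a)%N *+ (w %% a == j + x)%N).
Proof.
move=> et ix jx xt.
rewrite (big_cat_nat (n := t - x)) ?leq_subr //=.
rewrite [X in _ + X]big1_seq ?addr0; last first.
  move=> w; rewrite mem_index_iota => /andP[_ /andP[tw wt]].
  (* If [w] had residue [i], then [w] and [w + x] would have the same quotient by [e], although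
     [w < t <= w + x] and [e] divides [t]. *)
  case: eqP => [iw|_]; last by rewrite mulr0n mul0r.
  have := divn_mod_shift ix (esym iw).
  have : (t %/ e <= (w + x) %/ e)%N by apply: leq_div2r; lia.
  by have := ltn_divLR w (t %/ e) (leq_ltn_trans (leq0n _) ix); rewrite divnK //; lia.
rewrite [RHS](big_cat_nat (n := x)) //=.
rewrite [X in _ = X + _]big1_seq ?add0r; last first.
  move=> w; rewrite mem_index_iota => /andP[_ /andP[_ wx]].
  (* Here [w < x <= i + x < e], so the residue of [w] is [w] itself and differs from [i + x]. *)
  case: eqP => [|_]; last by rewrite mulr0n mul0r.
  by rewrite modn_small; lia.
(* The remaining range on the right is the translate by [x] of the one on the left. *)
rewrite -{2}[x]add0n big_addn; apply: eq_bigr => w _.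
have -> : (i + x == (w + x) %% e)%N = (i == w %% e)%N.
  by rewrite -{1}(modn_small ix) eqn_modDr modn_small //; lia.
have -> : ((w + x) %% a == j + x)%N = (w %% a == j)%N.
  by rewrite -{1}(modn_small jx) eqn_modDr (@modn_small j) //; lia.
case: eqP => [iw|_]; last by rewrite !mulr0n !mul0r.
case: eqP => [jw|_]; last by rewrite !mulr0n !mulr0.
by rewrite (divn_mod_shift ix) // (divn_mod_shift jx).
Qed.

Lemma muln_ordD_lt (m e u i : nat) : (u < m)%N -> (i < e)%N ->
  (u * e + i < m * e)%N.
Proof. by nia. Qed.

(** The offsets [u * e] and [v * a] fix the quotients and leave [i] and [j] as residues, so each
    inner sum has the form treated in [sum_residue_shift]. *)
Lemma stprod_block_shift (K : pzRingType) (m n r p q s : nat)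
    (A : tensor K m n r) (B : tensor K p q s) (k u v i j x : nat) :
  let e := (lcmn n p %/ n)%N in let a := (lcmn n p %/ p)%N in
  (0 < lcmn n p)%N ->
  (k < lcmn r s)%N -> (u < m)%N -> (v < q)%N -> (i + x < e)%N -> (j + x < a)%N ->
  tent (stprod A B) k (u * e + i) (v * a + j) =
  tent (stprod A B) k (u * e + (i + x)) (v * a + (j + x)).
Proof.
move=> e a t_gt0 hk hu hv ix jx.
have ie : (i < e)%N by lia.
have ja : (j < a)%N by lia.
rewrite !tent_stprod ?muln_ordD_lt // -/e -/a.
have e_gt0 : (0 < e)%N by lia.
have a_gt0 : (0 < a)%N by lia.
rewrite !modnMDl !divnMDl // !(@divn_small _ e) // !(@divn_small _ a) //.
rewrite !(@modn_small i) // !(@modn_small j) // !(modn_small ix) !(modn_small jx).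
apply: eq_bigr => c _; apply: eq_bigr => c' _; rewrite !addn0.
(* The slice conditions do not involve [w]; when one of them fails, both sums vanish. *)
case: eqP => _ /=; last by apply: eq_bigr => w _; rewrite !mul0r.
case: eqP => _ /=; last by apply: eq_bigr => w _; rewrite !mulr0.
apply: (@sum_residue_shift K (lcmn n p) e a i j x
  (fun w => tent A _ u w) (fun w => tent B _ w v)) => //.
- by rewrite /e dvdn_div ?dvdn_lcml.
- have := leq_div (lcmn n p) n; rewrite -/e; lia.
Qed.

(** Two positions on one diagonal of a block differ by a common shift; [i + j' = i' + j] expresses
    this without subtraction. *)
Lemma stprod_block_toeplitz (K : pzRingType) (m n r p q s : nat)
    (A : tensor K m n r) (B : tensor K p q s) (k u v i j i' j' : nat) :
  let e := (lcmn n p %/ n)%N in let a := (lcmn n p %/ p)%N in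
  (0 < lcmn n p)%N ->
  (k < lcmn r s)%N -> (u < m)%N -> (v < q)%N ->
  (i < e)%N -> (j < a)%N -> (i' < e)%N -> (j' < a)%N ->
  (i + j' = i' + j)%N ->
  tent (stprod A B) k (u * e + i) (v * a + j) =
  tent (stprod A B) k (u * e + i') (v * a + j').
Proof.
move=> e a t_gt0 hk hu hv hi hj hi' hj' ij.
wlog ii' : i j i' j' hi hj hi' hj' ij / (i <= i')%N.
  move=> W; case: (leqP i i') => [|/ltnW] ii'; first exact: W.
  by apply/esym/W.
have -> : i' = (i + (i' - i))%N by lia.
have -> : j' = (j + (i' - i))%N by lia.
by apply: stprod_block_shift => //; rewrite -/e -/a; lia.
Qed.

(** The size equations make the blocks of [T] the natural blocks of the product. Both factors are
    general tensors, so the unknown may stand on either side. *)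
Lemma teq_stprod_toeplitz (K : pzRingType) (m n r p q s h k e : nat)
    (A : tensor K m n r) (B : tensor K p q s) (T : tensor K h k e)
    (u : 'I_m) (v : 'I_q) :
  (0 < lcmn n p)%N -> teq (stprod A B) T -> toeplitz_tensor (tblock T u v).
Proof.
move=> t_gt0 /teqP[hE kE eE AB] c i i' j j' ij.
have m_gt0 : (0 < m)%N := leq_ltn_trans (leq0n _) (ltn_ord u).
have q_gt0 : (0 < q)%N := leq_ltn_trans (leq0n _) (ltn_ord v).
rewrite !ffunE !mxE -!tentE -!AB ?eE ?hE ?kE ?ltn_ord //=.
have hm : (h %/ m = lcmn n p %/ n)%N by rewrite -hE mulKn.
have kq : (k %/ q = lcmn n p %/ p)%N by rewrite -kE mulKn.
(* Only the block offsets are rewritten; the types of the ordinals keep [h %/ m] and [k %/ q]. *)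
rewrite {1 3}hm {1 3}kq; apply: stprod_block_toeplitz; rewrite -?hm -?kq ?eE //.
by lia.
Qed.

(** * Splitting the equations into columns and rows of the unknown *)

Lemma tent_mx_tensor_col (K : nmodType) (p q : nat) (X : 'M[K]_(p, q))
    (j : 'I_q) (c w : nat) :
  tent (mx_tensor (col j X)) c w 0 = tent (mx_tensor X) c w j.
Proof.
rewrite /tent -[0%N]/(val (ord0 : 'I_1)) !valK.
by case: (insub c) => // c'; case: (insub w) => // w'; rewrite !ffunE mxE.
Qed.

Lemma tent_mx_tensor_row (K : nmodType) (p q : nat) (X : 'M[K]_(p, q))
    (g : 'I_p) (c w : nat) :
  tent (mx_tensor (row g X)) c 0 w = tent (mx_tensor X) c g w.
Proof.
rewrite /tent -[0%N]/(val (ord0 : 'I_1)) !valK.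
by case: (insub c) => // c'; case: (insub w) => // w'; rewrite !ffunE mxE.
Qed.

(** The column index on the right has quotient [v], so only column [v] of [X] is read; a column
    keeps all [p] rows, hence the same lcm. *)
Lemma tent_stprod_col (K : pzRingType) (m n r p q : nat)
    (A : tensor K m n r) (X : 'M[K]_(p, q)) (v : 'I_q) (k i j : nat) :
  (k < lcmn r 1)%N -> (i < m * (lcmn n p %/ n))%N -> (j < lcmn n p %/ p)%N ->
  tent (stprod A (mx_tensor (col v X))) k i j =
  tent (stprod A (mx_tensor X)) k i (v * (lcmn n p %/ p) + j).
Proof.
move=> hk hi hj; rewrite !tent_stprod ?mul1n ?muln_ordD_lt //.
apply: eq_bigr => c _; apply: eq_bigr => c' _; apply: eq_bigr => w _.
have a_gt0 : (0 < lcmn n p %/ p)%N by exact: leq_ltn_trans hj.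
by rewrite divnMDl // modnMDl (divn_small hj) addn0 tent_mx_tensor_col.
Qed.

Lemma tent_stprod_row (K : pzRingType) (p q a b r : nat)
    (X : 'M[K]_(p, q)) (C : tensor K a b r) (g : 'I_p) (k i j : nat) :
  (k < lcmn 1 r)%N -> (i < lcmn q a %/ q)%N -> (j < b * (lcmn q a %/ a))%N ->
  tent (stprod (mx_tensor (row g X)) C) k i j =
  tent (stprod (mx_tensor X) C) k (g * (lcmn q a %/ q) + i) j.
Proof.
move=> hk hi hj; rewrite !tent_stprod ?mul1n ?muln_ordD_lt //.
apply: eq_bigr => c _; apply: eq_bigr => c' _; apply: eq_bigr => w _.
have a_gt0 : (0 < lcmn q a %/ q)%N by exact: leq_ltn_trans hi.
by rewrite divnMDl // modnMDl (divn_small hi) addn0 tent_mx_tensor_row.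
Qed.

(** Stacking undoes the row partition: quotient and remainder by [h %/ m] reassemble [i]. *)
Lemma tent_tvstack (K : nmodType) (h k r m q : nat) (B : tensor K h k r)
    (j : 'I_q) (c i y : nat) :
  (c < r)%N -> (i < m * (h %/ m))%N -> (y < k %/ q)%N ->
  tent (tvstack (fun u : 'I_m => tblock B u j)) c i y =
  tent B c i (j * (k %/ q) + y).
Proof.
move=> hc hi hy; rewrite tent_ord ffunE mxE ffunE mxE -tentE /=.
by rewrite -divn_eq.
Qed.

Lemma tent_thstack (K : nmodType) (l d r p b : nat) (D : tensor K l d r)
    (g : 'I_p) (c x j : nat) :
  (c < r)%N -> (x < l %/ p)%N -> (j < b * (d %/ b))%N ->
  tent (thstack (fun s : 'I_b => tblock D g s)) c x j =
  tent D c (g * (l %/ p) + x) j.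
Proof.
move=> hc hx hj; rewrite tent_ord ffunE mxE ffunE mxE -tentE /=.
by rewrite -divn_eq.
Qed.

(** The equation for column [j] is the full equation restricted to the [j]-th column block, and
    these blocks cover all columns. *)
Lemma teq_stprod_cols (K : pzRingType) (m n h k r p q : nat)
    (A : tensor K m n r) (B : tensor K h k r) (X : 'M[K]_(p, q)) :
  (0 < m)%N -> (0 < q)%N -> (0 < lcmn n p)%N ->
  (m * (lcmn n p %/ n) = h)%N -> (q * (lcmn n p %/ p) = k)%N ->
  teq (stprod A (mx_tensor X)) B <->
  forall j : 'I_q, teq (stprod A (mx_tensor (col j X)))
                       (tvstack (fun u : 'I_m => tblock B u j)).
Proof.
move=> m_gt0 q_gt0 t_gt0 hE kE.
have hm : (h %/ m = lcmn n p %/ n)%N by rewrite -hE mulKn.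
have kq : (k %/ q = lcmn n p %/ p)%N by rewrite -kE mulKn.
split=> [/teqP[_ _ rE AB] v|AB].
  apply/teqP; split; rewrite ?mul1n ?hm ?kq //.
  move=> c i j hc hi hj; rewrite mul1n in hj.
  have hc' : (c < r)%N by rewrite rE in hc.
  rewrite tent_tvstack ?hm ?kq //.
  by rewrite tent_stprod_col // AB ?muln_ordD_lt.
apply/teqP; split; rewrite ?lcmn1 // => c i y hc hi hy.
(* A column index [y] exists, so the block width is positive and the quotient of [y] names its
   block. *)
have a_gt0 : (0 < lcmn n p %/ p)%N by move: hy; case: (_ %/ _)%N; lia.
have hv : (y %/ (lcmn n p %/ p) < q)%N by rewrite ltn_divLR.
have /teqP[_ _ rE {}AB] := AB (Ordinal hv).
have hw : (y %% (lcmn n p %/ p) < lcmn n p %/ p)%N by rewrite ltn_mod.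
have hc' : (c < r)%N by rewrite rE in hc.
have := AB c i (y %% (lcmn n p %/ p))%N hc hi.
rewrite tent_stprod_col // tent_tvstack ?hm ?kq // -divn_eq.
by apply; rewrite mul1n.
Qed.

(** Row blocks of height [lcmn q a %/ q] cover all rows, and block [g] sees only row [g] of [X]. *)
Lemma teq_stprod_rows (K : pzRingType) (a b l d r p q : nat)
    (C : tensor K a b r) (D : tensor K l d r) (X : 'M[K]_(p, q)) :
  (0 < b)%N -> (0 < p)%N -> (0 < lcmn q a)%N ->
  (p * (lcmn q a %/ q) = l)%N -> (b * (lcmn q a %/ a) = d)%N ->
  teq (stprod (mx_tensor X) C) D <->
  forall g : 'I_p, teq (stprod (mx_tensor (row g X)) C)
                       (thstack (fun s : 'I_b => tblock D g s)).
Proof.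
move=> b_gt0 p_gt0 t_gt0 lE dE.
have lp : (l %/ p = lcmn q a %/ q)%N by rewrite -lE mulKn.
have db : (d %/ b = lcmn q a %/ a)%N by rewrite -dE mulKn.
split=> [/teqP[_ _ rE XC] g|XC].
  apply/teqP; split; rewrite ?mul1n ?lp ?db //.
  move=> c i j hc hi hj; rewrite mul1n in hi.
  have hc' : (c < r)%N by rewrite rE in hc.
  rewrite tent_thstack ?lp ?db //.
  by rewrite tent_stprod_row // XC ?muln_ordD_lt.
apply/teqP; split; rewrite ?lcm1n // => c x j hc hx hj.
have e_gt0 : (0 < lcmn q a %/ q)%N by move: hx; case: (_ %/ _)%N; lia.
have hg : (x %/ (lcmn q a %/ q) < p)%N by rewrite ltn_divLR.
have /teqP[_ _ rE {}XC] := XC (Ordinal hg).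
have hw : (x %% (lcmn q a %/ q) < lcmn q a %/ q)%N by rewrite ltn_mod.
have hc' : (c < r)%N by rewrite rE in hc.
have := XC c (x %% (lcmn q a %/ q))%N j hc.
rewrite tent_stprod_row // tent_thstack ?lp ?db // -divn_eq.
by apply; rewrite ?mul1n.
Qed.

Unset Implicit Arguments.
Set Strict Implicit.
Set Printing Implicit Defensive.

Theorem theorem4p9 (R : realType)
  (m n h k a b l d r p q : nat)
  (m_gt0 : (0 < m)%N) (n_gt0 : (0 < n)%N) (h_gt0 : (0 < h)%N)
  (k_gt0 : (0 < k)%N) (a_gt0 : (0 < a)%N) (b_gt0 : (0 < b)%N)
  (l_gt0 : (0 < l)%N) (d_gt0 : (0 < d)%N) (r_gt0 : (0 < r)%N)
  (p_gt0 : (0 < p)%N) (q_gt0 : (0 < q)%N)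
  (A : tensor R[i] m n r) (B : tensor R[i] h k r)
  (C : tensor R[i] a b r) (D : tensor R[i] l d r)
  (mDh : m <> h) (lDp : l <> p)
  (hE : (m * lcmn n p %/ n)%N = h) (kE : (q * lcmn n p %/ p)%N = k)
  (lE : (p * lcmn q a %/ q)%N = l) (dE : (b * lcmn q a %/ a)%N = d) :
  (exists X : 'M[R[i]]_(p, q),
      teq (stprod A (mx_tensor X)) B /\ teq (stprod (mx_tensor X) C) D)
  <->
  [/\ forall (u : 'I_m) (j : 'I_q), toeplitz_tensor (tblock B u j),
      forall (g : 'I_p) (s : 'I_b), toeplitz_tensor (tblock D g s)
    & exists X : 'M[R[i]]_(p, q),
        (forall j : 'I_q,
           teq (stprod A (mx_tensor (col j X)))
               (tvstack (fun u : 'I_m => tblock B u j)))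
        /\
        (forall g : 'I_p,
           teq (stprod (mx_tensor (row g X)) C)
               (thstack (fun s : 'I_b => tblock D g s)))].
Proof.
have tnp_gt0 : (0 < lcmn n p)%N by rewrite lcmn_gt0 n_gt0.
have tqa_gt0 : (0 < lcmn q a)%N by rewrite lcmn_gt0 q_gt0.
(* The assumptions divide last; divisibility moves the quotient inside, as in the sizes of
   [stprod]. *)
rewrite -muln_divA ?dvdn_lcml // in hE; rewrite -muln_divA ?dvdn_lcmr // in kE.
rewrite -muln_divA ?dvdn_lcml // in lE; rewrite -muln_divA ?dvdn_lcmr // in dE.
(* The splitting holds for each fixed [X], so one witness serves both sides of the equivalence. *)
have colsE X := teq_stprod_cols A B X m_gt0 q_gt0 tnp_gt0 hE kE.
have rowsE X := teq_stprod_rows C D X b_gt0 p_gt0 tqa_gt0 lE dE.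
split=> [[X [AX XC]]|[_ _ [X [AX XC]]]].
  split.
  - by move=> u j; apply: teq_stprod_toeplitz AX.
  - by move=> g s; apply: teq_stprod_toeplitz XC.
  by exists X; split; [apply/colsE | apply/rowsE].
by exists X; split; [apply/colsE | apply/rowsE].
Qed.
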